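(* Let $p\in\,]0,1]$ be a constant. The expected rumor spreading time of the push protocol with success probability $p$ on the complete graph with $n$ vertices is equal to $$\log_{1+p} n+\frac1p\ln n\pm O(1).$$
   Context: Push protocol with success probability $p$ on the complete graph with $n$ nodes: initially exactly one node is informed. In each round, every node that was informed at the beginning of the round calls a node chosen independently and uniformly at random from all $n$ nodes (including itself); each call independently is successful with probability $p$ and otherwise has no effect. Nodes that are successfully called by an informed node are informed from the end of that round on. The rumor spreading time is the number of rounds until all nodes are informed. $\pm O(1)$ denotes a deviation bounded in absolute value by a constant independent of $n$ (possibly depending on $p$), for all sufficiently large $n$. *)

(* Defs.v *)
From HB Require Import structures.
From mathcomp Require Import all_boot all_order all_algebra finmap.
From mathcomp Require Import all_classical all_reals all_analysis.

Set Implicit Arguments.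
Unset Strict Implicit.
Unset Printing Implicit Defensive.

Import Order.TTheory GRing.Theory Num.Theory.

Local Open Scope classical_set_scope.
Local Open Scope ring_scope.

(* The value type [E] is meant to carry the discrete sigma-algebra: the product
   rule is required for all sets of values. *)
Definition mutually_independent d (Omega : measurableType d) (R : realType)
    (P : probability Omega R) (I : choiceType) (E : Type)
    (X : I -> Omega -> E) : Prop :=
  forall (J : {fset I}) (B : I -> set E),
    P (\bigcap_(i in [set` J]) (X i @^-1` B i)) =
    (\prod_(i <- J) P (X i @^-1` B i))%E.

(* [call (t, v)] is the call made by node [v] in round [t.+1]: the pair of the
   called node and a flag telling whether the call succeeds.  Such a variable is
   provided for every round and every node; only those of informed nodes are
   used by [informed].  The law below is the product of the uniform
   distribution on the nodes and the Bernoulli distribution of parameter [p]. *)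
Record push_calls d (Omega : measurableType d) (R : realType)
    (P : probability Omega R) (p : R) (n : nat)
    (call : nat * 'I_n -> Omega -> 'I_n * bool) : Prop := PushCalls {
  call_measurable : forall i (B : set ('I_n * bool)),
    measurable (call i @^-1` B) ;
  call_law : forall i (w : 'I_n) (b : bool),
    P (call i @^-1` [set (w, b)]) = (n%:R^-1 * bernoulli_pmf p b)%:E ;
  call_independent : mutually_independent P call }.

(* Nodes informed at the end of round [t]. *)
Fixpoint informed (Omega : Type) (n : nat)
    (call : nat * 'I_n -> Omega -> 'I_n * bool) (v0 : 'I_n) (t : nat)
    (x : Omega) : {set 'I_n} :=
  if t is s.+1 then
    let A := informed call v0 s x in
    (A :|: [set w | [exists v in A, call (s, v) x == (w, true)]])%SET
  else [set v0]%SET.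

(* Equals [+oo] on the outcomes where some node is never informed. *)
Definition spreading_time (R : realType) (Omega : Type) (n : nat)
    (call : nat * 'I_n -> Omega -> 'I_n * bool) (v0 : 'I_n)
    (x : Omega) : \bar R :=
  ereal_inf [set (t%:R)%:E | t in
    [set t : nat | informed call v0 t x = [set: 'I_n]%SET]].

(* The library's ['E_P[_]] only covers real-valued functions, hence a bare
   integral. *)
Definition expected_spreading_time d (Omega : measurableType d) (R : realType)
    (P : probability Omega R) (n : nat)
    (call : nat * 'I_n -> Omega -> 'I_n * bool) (v0 : 'I_n) : \bar R :=
  (\int[P]_x spreading_time R call v0 x)%E.

(* Main.v *)
Require Import Defs.
From HB Require Import structures.
From mathcomp Require Import all_boot all_order all_algebra finmap.
From mathcomp Require Import all_classical all_reals all_analysis.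
From mathcomp Require Import measurable_realfun ring lra.

Import Order.TTheory GRing.Theory Num.Theory.

Local Open Scope ring_scope.

(* Let u be the number of uninformed nodes, x = (n - u) / n the informed
   fraction and q = (1 - p / n) ^ (n - u) the probability that a given uninformed
   node stays uninformed.  After one round the number u' of uninformed nodes has
   mean u q, variance at most u q (1 - q), and u - u' <= n - u.

   Drift argument: if a function f of u satisfies E f(u') <= f(u) - 1 whenever
   u > 0, then the expected spreading time is at most f(n - 1) - f(0), and dually
   for the reverse inequality.  The main term of both potentials is
   ln (n / (n - u)) / ln (1 + p) + ln (1 + u) / p.  Its first summand, the time
   to grow by the factor 1 + p per round, decreases by about 1 - x; the second
   one, the time to shrink by the factor exp (- p) per round, by about x.  The
   errors are O(x (1 - x) + (1 - x) / (n - u)) in the first and O(x / (1 + u)) or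
   O(x / sqrt (1 + u)) in the second, and are absorbed by bounded correction terms. *)

(** * Linear and quadratic bounds for logarithms and inverse square roots *)

Section LogInequalities.
Context {R : realType}.
Implicit Types a b r s x y z : R.

Lemma ln_le_subr1 r : 0 < r -> ln r <= r - 1.
Proof.
move=> r0; have /le_ln1Dx : -1 < r - 1 by lra.
by rewrite addrC subrK.
Qed.

Lemma ln_ge_1subV r : 0 < r -> 1 - r^-1 <= ln r.
Proof.
move=> r0; have := @ln_le_subr1 r^-1; rewrite invr_gt0 lnV// => /(_ r0); lra.
Qed.

(** The left side equals [1 - b / a], so this is [ln r >= 1 - 1 / r] at [r = a / b], written as an
    expansion around [b]. *)
Lemma lnB_ge_quad a b : 0 < a -> 0 < b ->
  (a - b) / b - (a - b) ^+ 2 / (a * b) <= ln a - ln b.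
Proof.
move=> a0 b0; rewrite -ln_div ?posrE//.
apply: le_trans (ln_ge_1subV _ (divr_gt0 a0 b0)).
by rewrite le_eqVlt; apply/orP; left; apply/eqP; field; lra.
Qed.

Lemma lnB_le a b : 0 < a -> 0 < b -> ln a - ln b <= (a - b) / b.
Proof.
move=> a0 b0; rewrite -ln_div ?posrE//.
apply: le_trans (ln_le_subr1 _ (divr_gt0 a0 b0)) _.
by rewrite mulrBl divff// gt_eqF.
Qed.

(* With [b ^+ 2] as the denominator of the error, as in the Taylor expansion,
   this would fail for [a] close to 1 and large [b]. *)
Lemma lnB_ge_quad_sqrt a b : 1 <= a -> 1 <= b ->
  (a - b) / b - 2 * (a - b) ^+ 2 / (b * Num.sqrt b) <= ln a - ln b.
Proof.
move=> a1 b1.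
have sa1 : 1 <= Num.sqrt a by rewrite -[1]sqrtr1 ler_sqrt; lra.
have sb1 : 1 <= Num.sqrt b by rewrite -[1]sqrtr1 ler_sqrt; lra.
have Ea : a = Num.sqrt a ^+ 2 by rewrite sqr_sqrtr; lra.
have Eb : b = Num.sqrt b ^+ 2 by rewrite sqr_sqrtr; lra.
(* With [s] and [t] the square roots, the difference of logarithms is [2 * ln (s / t)], and
   [ln r >= 1 - 1 / r] is applied to [s / t], which is closer to 1 than [a / b]. *)
move: (Num.sqrt a) (Num.sqrt b) sa1 sb1 Ea Eb => s t s1 t1 -> -> {a b a1 b1}.
have s0 : 0 < s by lra.
have t0 : 0 < t by lra.
have st0 : 0 < s / t by rewrite divr_gt0.
rewrite !lnXn// -mulrnBl -ln_div ?posrE// -[leRHS]mulr_natl.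
have H := ln_ge_1subV _ st0.
apply: (@le_trans _ _ (2 * (1 - (s / t)^-1))); last by lra.
rewrite -subr_ge0.
have -> : 2 * (1 - (s / t)^-1) - ((s ^+ 2 - t ^+ 2) / t ^+ 2
    - 2 * (s ^+ 2 - t ^+ 2) ^+ 2 / (t ^+ 2 * t)) =
  (s - t) ^+ 2 / (s * t ^+ 3) * (2 * s * (s + t) ^+ 2 - t * (s + 2 * t)).
  by field; lra.
apply: mulr_ge0.
  by rewrite divr_ge0 ?sqr_ge0// mulr_ge0// ?exprn_ge0; lra.
rewrite subr_ge0.
(* The factor [s] may be dropped because [a >= 1]; what remains dominates [t * (s + 2 * t)]. *)
have : 2 * (s + t) ^+ 2 <= 2 * s * (s + t) ^+ 2.
  by rewrite ler_wpM2r ?sqr_ge0//; lra.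
apply: le_trans; nra.
Qed.

(** Convexity of [1 / sqrt]: the graph lies above its tangent at [b]. *)
Lemma invr_sqrt_ge_tangent a b : 0 < a -> 0 < b ->
  (Num.sqrt b)^-1 - (a - b) / (2 * b * Num.sqrt b) <= (Num.sqrt a)^-1.
Proof.
move=> a0 b0.
have s0 : 0 < Num.sqrt a by rewrite sqrtr_gt0.
have t0 : 0 < Num.sqrt b by rewrite sqrtr_gt0.
have Ea : a = Num.sqrt a ^+ 2 by rewrite sqr_sqrtr; lra.
have Eb : b = Num.sqrt b ^+ 2 by rewrite sqr_sqrtr; lra.
rewrite {1}Ea {2 3}Eb.
move: (Num.sqrt a) (Num.sqrt b) s0 t0 => s t s0 t0.
rewrite -subr_ge0.
have -> : s^-1 - (t^-1 - (s ^+ 2 - t ^+ 2) / (2 * t ^+ 2 * t)) =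
   (s - t) ^+ 2 * (s + 2 * t) / (2 * s * t ^+ 3) by field; lra.
apply: divr_ge0; apply: mulr_ge0; [exact: sqr_ge0|lra|lra|].
by apply: exprn_ge0; lra.
Qed.

End LogInequalities.

(** * Expectations over a finite probability space *)

Section FiniteExpectation.
Context {R : realType} {T : finType} (P : T -> R).
Hypothesis P_ge0 : forall c, 0 <= P c.
Hypothesis P_sum : \sum_c P c = 1.

Definition Ex (F : T -> R) : R := \sum_c P c * F c.

Lemma Ex_cst a : Ex (fun=> a) = a.
Proof. by rewrite /Ex -mulr_suml P_sum mul1r. Qed.

Lemma ExD F G : Ex (fun c => F c + G c) = Ex F + Ex G.
Proof. by rewrite /Ex -big_split; apply: eq_bigr => c _; rewrite /= mulrDr. Qed.

Lemma ExZ a F : Ex (fun c => a * F c) = a * Ex F.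
Proof. by rewrite /Ex mulr_sumr; apply: eq_bigr => c _; rewrite mulrCA. Qed.

Lemma le_Ex F G : (forall c, F c <= G c) -> Ex F <= Ex G.
Proof. by move=> FG; apply: ler_sum => c _; rewrite ler_wpM2l. Qed.

Variables (w : T -> R) (V : R).
Hypothesis w_var : Ex (fun c => (w c - Ex w) ^+ 2) <= V.

Lemma Ex_affine_quad a b g :
  Ex (fun c => a + b * (w c - Ex w) + g * (w c - Ex w) ^+ 2) =
  a + g * Ex (fun c => (w c - Ex w) ^+ 2).
Proof.
rewrite (ExD (fun c => a + b * (w c - Ex w)) (fun c => g * (w c - Ex w) ^+ 2)).
rewrite (ExD (fun=> a) (fun c => b * (w c - Ex w))) Ex_cst.
by rewrite !ExZ (ExD w (fun=> - Ex w)) Ex_cst subrr mulr0 addr0.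
Qed.

(** The slope [b] is free, since the deviation from the mean averages to zero; [g = 0] gives
    Jensen's inequality from a supporting line. *)
Lemma le_Ex_quad F a b g : 0 <= g ->
  (forall c, F c <= a + b * (w c - Ex w) + g * (w c - Ex w) ^+ 2) ->
  Ex F <= a + g * V.
Proof.
move=> g0 /le_Ex/le_trans; apply; rewrite Ex_affine_quad lerD2l.
exact: ler_wpM2l.
Qed.

Lemma ge_Ex_quad F a b g : 0 <= g ->
  (forall c, a + b * (w c - Ex w) - g * (w c - Ex w) ^+ 2 <= F c) ->
  a - g * V <= Ex F.
Proof.
move=> g0 H.
have /le_Ex : forall c, a + b * (w c - Ex w) + (- g) * (w c - Ex w) ^+ 2 <= F c.
  by move=> c; rewrite mulNr.
apply: le_trans; rewrite Ex_affine_quad mulNr lerD2l lerN2.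
exact: ler_wpM2l.
Qed.

End FiniteExpectation.

(** * Powers of [1 - y], the probability of being missed by [k] callers *)

Section MissProbability.
Context {R : realType} {y : R}.
Hypotheses (y_gt0 : 0 < y) (y_le : y <= 2^-1).
Implicit Type k : nat.

Ltac yfacts := move: (y_gt0) (y_le) => ? ?.

Lemma expr1B_gt0 k : 0 < (1 - y) ^+ k.
Proof. by yfacts; rewrite exprn_gt0//; lra. Qed.

Lemma expr1B_ge k : 1 - k%:R * y <= (1 - y) ^+ k.
Proof.
yfacts.
elim: k => [|k IH]; first by rewrite mul0r subr0 expr0.
have := ler0n R k; rewrite exprS -natr1.
have y1 : 0 <= 1 - y by lra.
move: (ler_wpM2l y1 IH) => IH' k0.
by apply: le_trans IH'; move: k%:R k0 => z z0; nra.
Qed.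

Lemma expr1D_ge k : 1 + k%:R * y <= (1 + y) ^+ k.
Proof.
yfacts.
elim: k => [|k IH]; first by rewrite mul0r addr0 expr0.
have := ler0n R k; rewrite exprS -natr1.
have y1 : 0 <= 1 + y by lra.
move: (ler_wpM2l y1 IH) => IH' k0.
by apply: le_trans IH'; move: k%:R k0 => z z0; nra.
Qed.

(** Bernoulli's inequality bounds [1 + k y] by [(1 + y) ^ k], and [(1 - y) (1 + y) <= 1]. *)
Lemma expr1B_le k : (1 - y) ^+ k * (1 + k%:R * y) <= 1.
Proof.
yfacts.
apply: le_trans (ler_wpM2l (ltW (expr1B_gt0 k)) (expr1D_ge k)) _.
by rewrite -exprMn exprn_ile1//; nra.
Qed.

Lemma ln_expr1B k : ln ((1 - y) ^+ k) = k%:R * ln (1 - y).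
Proof. by yfacts; rewrite lnXn ?mulr_natl//; lra. Qed.

Lemma ln_expr1B_le k : ln ((1 - y) ^+ k) <= - (k%:R * y).
Proof.
yfacts.
rewrite ln_expr1B -mulrN ler_wpM2l//.
have := ln_le_subr1 (1 - y); lra.
Qed.

Lemma ln_expr1B_ge_div k : - (k%:R * (y / (1 - y))) <= ln ((1 - y) ^+ k).
Proof.
yfacts.
rewrite ln_expr1B -mulrN ler_wpM2l//.
apply: le_trans (ln_ge_1subV (1 - y) _); last by lra.
by rewrite le_eqVlt; apply/orP; left; apply/eqP; field; lra.
Qed.

(** The bound [y / (1 - y) <= y + 2 y^2] amounts to [y^2 (1 - 2 y) >= 0], which holds for
    [y <= 1 / 2]. *)
Lemma ln_expr1B_ge k : - (k%:R * (y + 2 * y ^+ 2)) <= ln ((1 - y) ^+ k).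
Proof.
yfacts.
apply: le_trans (ln_expr1B_ge_div k).
rewrite lerN2 ler_wpM2l// ler_pdivrMr; last by lra.
nra.
Qed.

(** The hypothesis says that [k y / (1 - y)] is at most 1. The bound keeps [q] away from 0 uniformly
    in [n]. *)
Lemma expr1B_ge_expRN1 k : k%:R * y <= 1 - y -> expR (- 1) <= (1 - y) ^+ k.
Proof.
yfacts.
move=> ky; rewrite -[leRHS]lnK ?posrE ?expr1B_gt0// ler_expR.
apply: le_trans (ln_expr1B_ge_div k); rewrite lerN2 mulrA ler_pdivrMr; lra.
Qed.

End MissProbability.

(** * The two potential functions *)

Section Potentials.
Context {R : realType}.
Implicit Types p n K A B u : R.

(* The drift of [u / (1 + u)] pays for the errors in the drift of [ln (1 + u)],
   those of [u / n] and [1 / (n - u)] for the errors in the drift of [ln (n - u)]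
   due to collisions between calls and to the fluctuations of [u]. *)
Definition potential_upper p n K A B u : R :=
  (ln n - ln (n - u)) / ln (1 + p) + (ln (1 + u) + K * (u / (1 + u))) / p +
  A * (u / n) + B / (n - u).

(** Here the corrections must increase during a round: [- A * (u / n)] offsets the excess decrease
    of the growth term, and [B / sqrt (1 + u)] the errors in [ln (1 + u)]. *)
Definition potential_lower p n A B u : R :=
  (ln n - ln (n - u)) / ln (1 + p) + ln (1 + u) / p -
  A * (u / n) + B / Num.sqrt (1 + u).

End Potentials.

(** * Drift in one round, from the mean and variance of the number of uninformed nodes *)

Section Drift.
Context {R : realType} {T : finType} (P : T -> R) (w : T -> R) (p n u q : R).
Hypotheses (P_ge0 : forall c, 0 <= P c) (P_sum : \sum_c P c = 1).
Hypotheses (p_gt0 : 0 < p) (p_le1 : p <= 1).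
Hypotheses (n_ge2 : 2 <= n) (u_ge1 : 1 <= u) (u_le : u <= n - 1).
Hypotheses (w_ge0 : forall c, 0 <= w c) (w_le : forall c, w c <= u).
Hypotheses (w_ge : forall c, u - w c <= n - u).
Hypotheses (Ew : Ex P w = u * q).
Hypothesis Vw : Ex P (fun c => (w c - Ex P w) ^+ 2) <= u * q * (1 - q).
Hypotheses (q_gt0 : 0 < q) (q_le : q * (1 + p * ((n - u) / n)) <= 1).
Hypotheses (q_ge : 1 - p * ((n - u) / n) <= q).

Ltac facts := move: (p_gt0) (p_le1) (n_ge2) (u_ge1) (u_le) (q_gt0) => ? ? ? ? ? ?.

Let x := (n - u) / n.

Let xE : n - u = x * n.
Proof. by facts; rewrite /x; field; lra. Qed.

Let x_gt0 : 0 < x.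
Proof. by facts; rewrite divr_gt0; lra. Qed.

Let x_lt1 : x < 1.
Proof. by facts; rewrite ltr_pdivrMr; lra. Qed.

Let lam := ln (1 + p).

Let lam_gt0 : 0 < lam.
Proof. by facts; rewrite ln_gt0//; lra. Qed.

Let lam_le : lam <= p.
Proof. by facts; rewrite le_ln1Dx//; lra. Qed.

Let qx_le : q * (1 + p * x) <= 1.
Proof. exact: q_le. Qed.

Let qx_ge : 1 - p * x <= q.
Proof. exact: q_ge. Qed.

Let px_gt0 : 0 < p * x.
Proof. exact: mulr_gt0. Qed.

Let q_lt1 : q < 1.
Proof.
by have := mulr_gt0 q_gt0 px_gt0; have := qx_le; rewrite mulrDr mulr1; lra.
Qed.

(** From [q (1 + z) <= 1] with [z = p x <= 1] follows [1 - q >= z / (1 + z) >= z / 2]. *)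
Let d_ge : p * x / 2 <= 1 - q.
Proof.
facts; move: (px_gt0) (x_lt1) (qx_le) => px0 x1 qx.
have px1 : p * x <= 1 by nra.
move: (p * x) px0 qx px1 => z *; nra.
Qed.

Let Ex_tangent F a b : (forall c, F c <= a + b * (w c - Ex P w)) -> Ex P F <= a.
Proof.
facts.
move=> H; rewrite -[leRHS]addr0 -[X in _ + X](mul0r (u * q * (1 - q))).
by apply: (le_Ex_quad P P_ge0 P_sum w _ Vw F a b) => // c; rewrite mul0r addr0.
Qed.

Let Ex_tangent_ge F a b : (forall c, a + b * (w c - Ex P w) <= F c) -> a <= Ex P F.
Proof.
facts.
move=> H; rewrite -[leLHS]subr0 -[X in _ - X](mul0r (u * q * (1 - q))).
by apply: (ge_Ex_quad P P_ge0 P_sum w _ Vw F a b) => // c; rewrite mul0r subr0.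
Qed.

Lemma Ex_ln1D_le : Ex P (fun c => ln (1 + w c)) <= ln (1 + u * q).
Proof.
facts.
have m0 : 0 < u * q by rewrite mulr_gt0; lra.
apply: (Ex_tangent _ _ (1 + u * q)^-1) => c; rewrite Ew.
have w0 := w_ge0 c.
have := @lnB_le _ (1 + w c) (1 + u * q); rewrite mulrC.
rewrite opprD addrACA subrr add0r; lra.
Qed.

Lemma Ex_frac_le : Ex P (fun c => w c / (1 + w c)) <= u * q / (1 + u * q).
Proof.
facts.
have m0 : 0 < u * q by rewrite mulr_gt0; lra.
apply: (Ex_tangent _ _ ((1 + u * q) ^+ 2)^-1) => c; rewrite Ew.
have := w_ge0 c; move: (w c) (u * q) m0 => a m m0 a0.
rewrite -subr_ge0.
have -> : m / (1 + m) + (1 + m) ^- 2 * (a - m) - a / (1 + a) =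
  (a - m) ^+ 2 / ((1 + a) * (1 + m) ^+ 2) by field; lra.
by apply: divr_ge0; [exact: sqr_ge0|apply: mulr_ge0; [lra|apply: exprn_ge0; lra]].
Qed.

(** By concavity [w] may be replaced by its mean. Then [ln (1 + u q)] exceeds [ln q + ln (1 + u)] by
    at most [(1 - q) / (q (1 + u))], and the decrease of [K u / (1 + u)] pays for this excess. *)
Lemma Ex_shrink_le K : 2 <= K * q ->
  Ex P (fun c => ln (1 + w c) + K * (w c / (1 + w c))) <=
  ln (1 + u) + K * (u / (1 + u)) + ln q.
Proof.
facts.
move=> Kq; have K0 : 0 < K by rewrite -(pmulr_lgt0 _ q_gt0); lra.
rewrite (ExD P (fun c => ln (1 + w c)) (fun c => K * (w c / (1 + w c)))) ExZ.
apply: le_trans (lerD Ex_ln1D_le (ler_wpM2l (ltW K0) Ex_frac_le)) _.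
have m0 : 0 < u * q by rewrite mulr_gt0; lra.
have mu : u * q <= u by have := q_lt1; nra.
have q1 := q_lt1.
have : ln (1 + u * q) - ln (q * (1 + u)) <= (1 - q) / (q * (1 + u)).
  apply: le_trans (lnB_le _ _ _ _) _; first by lra.
    by rewrite mulr_gt0//; lra.
  rewrite le_eqVlt; apply/orP; left; apply/eqP; congr (_ / _); ring.
rewrite lnM ?posrE; [|lra|lra].
have -> : u * q / (1 + u * q) =
    u / (1 + u) - u * (1 - q) / ((1 + u) * (1 + u * q)) by field; lra.
suff : (1 - q) / (q * (1 + u)) <= K * (u * (1 - q) / ((1 + u) * (1 + u * q))) by lra.
have -> : K * (u * (1 - q) / ((1 + u) * (1 + u * q))) =
  (1 - q) / (q * (1 + u)) * (K * q * u / (1 + u * q)) by field; lra.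
(* The last factor is at least 1, because [K q >= 2] and [1 + u q <= 1 + u <= 2 u]. *)
apply: ler_peMr; first by rewrite divr_ge0// ?mulr_ge0//; lra.
rewrite ler_pdivlMr; last by lra.
rewrite mul1r; nra.
Qed.


Let d_le : 1 - q <= p * x.
Proof. by have := qx_ge; lra. Qed.

Let uE : u = n * (1 - x).
Proof. by have := xE; lra. Qed.

Let k_ge1 : 1 <= n - u.
Proof. by facts; lra. Qed.

Let ud_le : u * (1 - q) <= p * (n - u) * (1 - x).
Proof.
facts; rewrite xE uE.
have -> : p * (x * n) * (1 - x) = n * (1 - x) * (p * x) by ring.
have := d_le; have := x_lt1 => x1 dl.
by rewrite ler_wpM2l// mulr_ge0//; lra.
Qed.

Let ud_ge : p * (n - u) * (1 - x) / 2 <= u * (1 - q).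
Proof.
facts; rewrite xE uE.
have -> : p * (x * n) * (1 - x) / 2 = n * (1 - x) * (p * x / 2) by ring.
by have := x_lt1 => x1; rewrite ler_wpM2l// mulr_ge0//; lra.
Qed.

(** The right side is the expected number of newly informed nodes. With [z = p x], one has
    [1 - q >= z (1 - z)] and [(1 - x) (1 - z) >= 1 - 2 x]. *)
Let ud_ge2 : p * (n - u) * (1 - 2 * x) <= u * (1 - q).
Proof.
facts; rewrite xE uE.
have -> : p * (x * n) * (1 - 2 * x) = n * (p * x * (1 - 2 * x)) by ring.
rewrite -[leRHS]mulrA ler_wpM2l//; first lra.
move: (px_gt0) (x_gt0) (x_lt1) (qx_le) => px0 x0 x1 qx.
have dl : p * x * (1 - p * x) <= 1 - q.
  by move: (p * x) px0 qx => z *; nra.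
apply: le_trans (ler_wpM2l _ dl); last by lra.
have -> : (1 - x) * (p * x * (1 - p * x)) = p * x * ((1 - x) * (1 - p * x)) by ring.
by rewrite ler_wpM2l//; nra.
Qed.

(** The logarithm is expanded around [(1 + p) (n - u)]. Collisions, which lower the mean, cost at
    most [2 x] in the linear and [4 x] in the quadratic term; the variance, at most [n - u], costs
    [1 / (n - u)]. *)
Lemma Ex_ln_informed_ge :
  ln (n - u) + lam - 6 * x - (n - u)^-1 <= Ex P (fun c => ln (n - w c)).
Proof.
(* [b] is the size after ideal growth, and [e] is the mean of [n - w] minus [b]. *)
facts; set k := n - u; set b := (1 + p) * k; set e := u * (1 - q) - p * k.
have k1 : 1 <= k by [].
have b0 : 0 < b by rewrite mulr_gt0//; lra.
have x0 := x_gt0; have x1 := x_lt1.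
have k0 : 0 < k by lra.
have pkx : 0 < p * k * x := mulr_gt0 (mulr_gt0 p_gt0 k0) x0.
have e_le0 : e <= 0 by have := ud_le; rewrite -/k /e; lra.
have e_ge : - (2 * p * k * x) <= e by have := ud_ge2; rewrite -/k /e; lra.
have H : ln b + e / b - e ^+ 2 / k ^+ 2 - k ^- 2 * (u * q * (1 - q)) <=
    Ex P (fun c => ln (n - w c)).
  apply: (ge_Ex_quad P P_ge0 P_sum w _ Vw _ _ (- b^-1 + 2 * e / k ^+ 2)).
    by rewrite invr_ge0 sqr_ge0.
  move=> c; rewrite Ew.
  have ak : k <= n - w c by have := w_le c; rewrite /k; lra.
  have := @lnB_ge_quad _ (n - w c) b.
  (* Informed nodes stay informed, so both factors of the denominator are at least [k]; with the
     constant [k ^+ 2] the bound is quadratic in [w c]. *)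
  have : (n - w c - b) ^+ 2 / ((n - w c) * b) <= (n - w c - b) ^+ 2 / k ^+ 2.
    rewrite ler_wpM2l ?sqr_ge0// lef_pV2 ?posrE ?exprn_gt0 ?mulr_gt0//; try lra.
    by rewrite expr2 ler_pM//; rewrite /b; nra.
  have -> : ln b + e / b - e ^+ 2 / k ^+ 2 + (- b^-1 + 2 * e / k ^+ 2) * (w c - u * q)
     - k ^- 2 * (w c - u * q) ^+ 2 =
     ln b + ((n - w c - b) / b - (n - w c - b) ^+ 2 / k ^+ 2).
    have -> : n - w c - b = e - (w c - u * q) by rewrite /b /e /k; ring.
    by field; lra.
  by move=> h1 h2; have := h2 _ b0; lra.
apply: le_trans H.
have -> : ln b = lam + ln k by rewrite lnM ?posrE//; lra.
have V1 : k ^- 2 * (u * q * (1 - q)) <= k^-1.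
  have -> : k ^- 2 * (u * q * (1 - q)) = k^-1 * (k^-1 * (u * q * (1 - q))) by field; lra.
  apply: ler_piMr; first by rewrite invr_ge0; lra.
  rewrite ler_pdivrMl; last by lra.
  have := ud_le; rewrite -/k mulr1 [u * q * _]mulrAC => ud.
  have : 0 <= u * (1 - q) by rewrite mulr_ge0//; have := q_lt1; lra.
  have := q_lt1 => q1.
  move: (u * (1 - q)) ud => z ud z0.
  have q10 : 0 <= 1 - q by lra.
  have zq := mulr_ge0 z0 q10.
  apply: (@le_trans _ _ z); first by lra.
  have p1x : 0 <= 1 - p * (1 - x) by have := mulr_gt0 p_gt0 x0; lra.
  have := mulr_ge0 (ltW k0) p1x => kp1x.
  by apply: le_trans ud _; lra.
have e1 : - (2 * x) <= e / b.
  rewrite ler_pdivlMr//; apply: le_trans e_ge.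
  have -> : - (2 * x) * b = - (2 * p * k * x) - 2 * (k * x) by rewrite /b; ring.
  by have := mulr_gt0 k0 x0; lra.
have e2 : e ^+ 2 / k ^+ 2 <= 4 * x.
  rewrite ler_pdivrMr ?exprn_gt0//.
  apply: (@le_trans _ _ ((2 * p * k * x) ^+ 2)).
    by rewrite -(sqrrN e) ler_pXn2r ?nnegrE//; lra.
  have := sqr_ge0 k.
  have : p ^+ 2 * x ^+ 2 <= x.
    have p2 : p ^+ 2 <= 1 by rewrite exprn_ile1//; lra.
    by apply: le_trans (ler_piMl (sqr_ge0 x) p2) _; rewrite expr2; nra.
  have -> : (2 * p * k * x) ^+ 2 = 4 * (p ^+ 2 * x ^+ 2) * k ^+ 2 by ring.
  move: (k ^+ 2) => K2 h1 h2.
  by rewrite ler_wpM2r//; lra.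
lra.
Qed.

Lemma Ex_ln_informed_mono : ln (n - u) <= Ex P (fun c => ln (n - w c)).
Proof.
facts; rewrite -[leLHS](Ex_cst P P_sum) le_Ex// => c.
by have := w_le c => wu; rewrite ler_ln ?posrE; lra.
Qed.

(** On [0 <= D <= k] the convex function [1 / (k + D)] lies below its chord [1 / k - D / (2 k^2)];
    the number [D] of newly informed nodes is at most [k = n - u]. *)
Lemma Ex_inv_informed_le :
  Ex P (fun c => (n - w c)^-1) <= (n - u)^-1 - u * (1 - q) / (2 * (n - u) ^+ 2).
Proof.
apply: (Ex_tangent _ _ (2 * (n - u) ^+ 2)^-1) => c; rewrite Ew.
facts; have D_le := w_ge c.
have D_ge : 0 <= u - w c by have := w_le c; lra.
have -> : n - w c = n - u + (u - w c) by ring.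
have -> : w c - u * q = u * (1 - q) - (u - w c) by ring.
have : 0 < n - u by lra.
move: (n - u) (u - w c) (u * (1 - q)) D_le D_ge => k D e Dk D0 k0.
rewrite -subr_ge0.
have -> : k^-1 - e / (2 * k ^+ 2) + (2 * k ^+ 2)^-1 * (e - D) - (k + D)^-1 =
   D * (k - D) / (2 * k ^+ 2 * (k + D)) by field; lra.
apply: divr_ge0; first by rewrite mulr_ge0//; lra.
by apply: mulr_ge0; [have := sqr_ge0 k; lra|lra].
Qed.

(** The shrinking part drops by [x], so the other terms must drop by [1 - x]. For [x <= 1 / 2] the
    growth term drops by at least [1 - 6 x / lam - 1 / ((n - u) lam)], and the [A] and [B] terms
    recover the two losses. *)
Lemma Ex_potential_upper_le (K A B : R) : ln q <= - (p * x) ->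
  2 <= K * q -> 24 <= A * p * lam -> 8 <= B * p * lam ->
  Ex P (fun c => potential_upper p n K A B (w c)) <=
  potential_upper p n K A B u - 1.
Proof.
move=> lnq Kq HA HB; facts; rewrite /potential_upper -/lam.
have lam0 := lam_gt0; have laml := lam_le; have x0 := x_gt0; have x1 := x_lt1.
have pl : 0 < p * lam := mulr_gt0 p_gt0 lam0.
have A0 : 0 < A by rewrite -(pmulr_lgt0 _ pl) mulrA; lra.
have B0 : 0 < B by rewrite -(pmulr_lgt0 _ pl) mulrA; lra.
pose S c := ln (1 + w c) + K * (w c / (1 + w c)).
pose I c := (n - w c)^-1.
pose L c := ln (n - w c).
have -> : Ex P (fun c => (ln n - ln (n - w c)) / lam +
      (ln (1 + w c) + K * (w c / (1 + w c))) / p + A * (w c / n) + B / (n - w c)) =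
    (ln n - Ex P L) / lam + Ex P S / p + A * (u * q / n) + B * Ex P I.
  rewrite -Ew (_ : (fun _ => _) = fun c => ln n / lam + (- lam^-1 * L c +
     (p^-1 * S c + (A / n * w c + B * I c)))).
    rewrite (ExD P (fun=> _) (fun c => - lam^-1 * L c + _)) Ex_cst//.
    rewrite (ExD P (fun c => - lam^-1 * L c) (fun c => p^-1 * S c + _)) ExZ.
    rewrite (ExD P (fun c => p^-1 * S c) (fun c => A / n * w c + _)) ExZ.
    rewrite (ExD P (fun c => A / n * w c) (fun c => B * I c)) !ExZ.
    ring.
  by apply/funext => c; rewrite /L /S /I; ring.
have HS : Ex P S / p <= (ln (1 + u) + K * (u / (1 + u))) / p - x.
  rewrite ler_pdivrMr// mulrBl divfK; last by lra.
  by have := Ex_shrink_le _ Kq; rewrite -/S; lra.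
have HI := Ex_inv_informed_le; rewrite -/I in HI.
have HL0 := Ex_ln_informed_mono; rewrite -/L in HL0.
have HL1 := Ex_ln_informed_ge; rewrite -/L in HL1.
have dge := d_ge; have d0 : 0 < 1 - q by have := px_gt0; lra.
have Aq : A * (u * q / n) = A * (u / n) - A * ((1 - x) * (1 - q)).
  by rewrite [u]uE; field; lra.
have BI : B * Ex P I <= B * (n - u)^-1 - B * (u * (1 - q) / (2 * (n - u) ^+ 2)).
  by rewrite -mulrBr ler_wpM2l//; lra.
suff : (ln (n - u) - Ex P L) / lam - A * ((1 - x) * (1 - q)) -
    B * (u * (1 - q) / (2 * (n - u) ^+ 2)) <= - (1 - x).
  by rewrite Aq !(mulrBl lam^-1); lra.
have ud0 : 0 <= u * (1 - q) by rewrite mulr_ge0; lra.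
(* For x > 1/2 the drift of [A * (u / n)] alone pays for the required 1 - x. *)
have [xle|xge] := lerP x 2^-1.
  have ud4 : p * (n - u) / 4 <= u * (1 - q).
    have := ud_ge; have : 0 < p * (n - u) by rewrite mulr_gt0//; lra.
    by move: (p * (n - u)) => z *; nra.
  have : (ln (n - u) - Ex P L) / lam <= - 1 + 6 * x / lam + (n - u)^-1 / lam.
    rewrite ler_pdivrMr// !mulrDl !divfK; lra.
  (* The constant 24: here [(1 - x) (1 - q) >= p x / 4]. *)
  have : 6 * x / lam <= A * ((1 - x) * (1 - q)).
    rewrite ler_pdivrMr//.
    apply: (@le_trans _ _ (A * (2^-1 * (p * x / 2)) * lam)).
      have -> : A * (2^-1 * (p * x / 2)) * lam = (A * p * lam) * (x / 4) by field.
      by have := ler_wpM2r (_ : 0 <= x / 4) HA; lra.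
    have px2 : 0 <= p * x / 2 by have := px_gt0; lra.
    apply: ler_wpM2r; first exact: ltW.
    by apply: ler_wpM2l; [exact: ltW|apply: ler_pM => //; lra].
  (* The constant 8: at least [p (n - u) / 4] nodes become informed on average, so the [B] term
     drops by at least [B p / (8 (n - u))]. *)
  have : (n - u)^-1 / lam <= B * (u * (1 - q) / (2 * (n - u) ^+ 2)).
    apply: (@le_trans _ _ (B * (p * (n - u) / 4 / (2 * (n - u) ^+ 2)))).
      have -> : B * (p * (n - u) / 4 / (2 * (n - u) ^+ 2)) =
         (n - u)^-1 / lam * (B * p * lam / 8) by field; lra.
      by apply: ler_peMr; rewrite ?divr_ge0 ?invr_ge0//; lra.
    rewrite ler_wpM2l ?ler_wpM2r ?invr_ge0 ?mulr_ge0 ?sqr_ge0//; lra.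
  lra.
have : (ln (n - u) - Ex P L) / lam <= 0.
  by rewrite pmulr_lle0 ?invr_gt0//; lra.
have : 0 <= B * (u * (1 - q) / (2 * (n - u) ^+ 2)).
  apply: mulr_ge0; first by lra.
  by apply: divr_ge0 => //; have := sqr_ge0 (n - u); lra.
suff : 1 - x <= A * ((1 - x) * (1 - q)) by lra.
rewrite mulrCA; apply: ler_peMr; first by lra.
(* Since [lam <= 1], the hypothesis on [A] gives [A p >= 24], while [1 - q >= p x / 2 >= p / 4]. *)
have Ap : 24 <= A * p by apply: le_trans HA _; apply: ler_piMr; [apply: mulr_ge0|]; lra.
have : A * (p * 4^-1) <= A * (1 - q).
  rewrite ler_wpM2l//; first by lra.
  by apply: le_trans dge; have := mulr_gt0 p_gt0 x0; nra.
lra.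
Qed.

(** Quadratic lower bound around the mean: the factor [u q] of the variance is below [1 + u q] and
    cancels it in the denominator, which leaves the square root. *)
Lemma Ex_ln1D_ge :
  ln (1 + u * q) - 2 * (1 - q) / Num.sqrt (1 + u * q) <=
  Ex P (fun c => ln (1 + w c)).
Proof.
facts; have m0 : 0 < u * q by rewrite mulr_gt0; lra.
set b := 1 + u * q; have b1 : 1 <= b by rewrite /b; lra.
have s0 : 0 < Num.sqrt b by rewrite sqrtr_gt0; lra.
have q1 := q_lt1.
apply: (@le_trans _ _ (ln b - 2 / (b * Num.sqrt b) * (u * q * (1 - q)))).
  rewrite lerD2l lerN2.
  have -> : 2 / (b * Num.sqrt b) * (u * q * (1 - q)) =
    2 * (1 - q) / Num.sqrt b * (u * q / b) by field; lra.
  apply: ler_piMr; first by rewrite divr_ge0; lra.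
  by rewrite ler_pdivrMr /b; lra.
apply: (ge_Ex_quad P P_ge0 P_sum w _ Vw _ _ b^-1).
  by rewrite divr_ge0// mulr_ge0; lra.
move=> c; rewrite Ew; have w0 := w_ge0 c.
have w1 : 1 <= 1 + w c by lra.
have := lnB_ge_quad_sqrt _ _ w1 b1.
have -> : 1 + w c - b = w c - u * q by rewrite /b; ring.
by lra.
Qed.

(** Jensen's inequality gives [1 / a] with [a = sqrt (1 + u q)]. Its gain over [1 / b] with
    [b = sqrt (1 + u)] follows from [b^2 - a^2 = u (1 - q)], [a <= b] and [b^2 <= 2 u]. *)
Lemma Ex_inv_sqrt_ge :
  (Num.sqrt (1 + u))^-1 + (1 - q) / (4 * Num.sqrt (1 + u * q)) <=
  Ex P (fun c => (Num.sqrt (1 + w c))^-1).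
Proof.
facts; have m0 : 0 < u * q by rewrite mulr_gt0; lra.
apply: (@le_trans _ _ (Num.sqrt (1 + u * q))^-1); last first.
  apply: (Ex_tangent_ge _ _ (- (2 * (1 + u * q) * Num.sqrt (1 + u * q))^-1)) => c.
  rewrite Ew; have w0 := w_ge0 c.
  have := @invr_sqrt_ge_tangent _ (1 + w c) (1 + u * q).
  have -> : 1 + w c - (1 + u * q) = w c - u * q by ring.
  by rewrite mulNr [_^-1 * _]mulrC; apply; lra.
have a1 : 0 < Num.sqrt (1 + u * q) by rewrite sqrtr_gt0; lra.
have q1 := q_lt1.
have ab : Num.sqrt (1 + u * q) <= Num.sqrt (1 + u).
  by rewrite ler_sqrt; [nra|lra].
have Ea : Num.sqrt (1 + u * q) ^+ 2 = 1 + u * q by rewrite sqr_sqrtr; lra.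
have Eb : Num.sqrt (1 + u) ^+ 2 = 1 + u by rewrite sqr_sqrtr; lra.
move: (Num.sqrt (1 + u * q)) (Num.sqrt (1 + u)) a1 ab Ea Eb => a b a0 ab Ea Eb.
have b0 : 0 < b by lra.
have Hab : b ^+ 2 - a ^+ 2 = u * (1 - q) by rewrite Ea Eb; ring.
suff : (1 - q) / (4 * a) <= a^-1 - b^-1 by lra.
have -> : a^-1 - b^-1 = u * (1 - q) / (a * b * (a + b)) by rewrite -Hab; field; lra.
rewrite ler_pdivrMr; last by lra.
have -> : u * (1 - q) / (a * b * (a + b)) * (4 * a) =
  (1 - q) * (4 * u / (b * (a + b))) by field; lra.
apply: ler_peMr; first by lra.
rewrite ler_pdivlMr; last by rewrite mulr_gt0//; lra.
have : b * (a + b) <= 2 * b ^+ 2 by nra.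
lra.
Qed.

(** By Jensen's inequality only the mean matters, and the mean number of informed nodes grows at
    most by the factor [1 + p (1 - x)]. *)
Lemma Ex_ln_informed_le :
  Ex P (fun c => ln (n - w c)) <= ln (n - u) + (1 - x) * lam + x * (1 - x) * p.
Proof.
facts; have x0 := x_gt0; have x1 := x_lt1.
have m0 : 0 < u * q by rewrite mulr_gt0; lra.
have mu : u * q <= u by have := q_lt1; nra.
apply: (@le_trans _ _ (ln (n - u * q))).
  apply: (Ex_tangent _ _ (- (n - u * q)^-1)) => c; rewrite Ew.
  have := w_le c; have := w_ge c => wg wl.
  have := @lnB_le _ (n - w c) (n - u * q).
  have -> : n - w c - (n - u * q) = - (w c - u * q) by ring.
  have a0 : 0 < n - w c by lra.
  have b0 : 0 < n - u * q by lra.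
  by move=> /(_ a0 b0); lra.
apply: (@le_trans _ _ (ln ((n - u) * (1 + p * (1 - x))))).
  have k0 : 0 < n - u by lra.
  have px1 : 0 <= p * (1 - x) by rewrite mulr_ge0; lra.
  rewrite ler_ln ?posrE; [|lra|rewrite mulr_gt0; lra].
  by have := ud_le; lra.
have px1 : 0 <= p * (1 - x) by rewrite mulr_ge0; lra.
rewrite lnM ?posrE; [|lra|lra].
rewrite -addrA lerD2l.
have h1 : ln (1 + p * (1 - x)) <= lam.
  by rewrite ler_ln ?posrE; [nra|lra|lra].
have h2 : ln (1 + p * (1 - x)) <= p * (1 - x) by rewrite le_ln1Dx; lra.
(* The combination of [h1] and [h2] with weights 1 - x and x. *)
have x1' : 0 <= 1 - x by lra.
have := ler_wpM2l x1' h1; have := ler_wpM2l (ltW x0) h2; lra.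
Qed.

(** The growth term drops by at most [1 - x] plus [x (1 - x) p / lam], which the [A] term recovers.
    The shrinking term drops by at most [x] plus errors of order [(1 - q) / sqrt (1 + u q)], which
    the [B] term recovers. *)
Lemma Ex_potential_lower_ge (A B : R) : - (p * x) - 2 * p ^+ 2 * x / n <= ln q ->
  2 <= A * lam -> 24 <= B * p ->
  potential_lower p n A B u - 1 <=
  Ex P (fun c => potential_lower p n A B (w c)).
Proof.
move=> lnq HA HB; facts; rewrite /potential_lower -/lam.
have lam0 := lam_gt0; have laml := lam_le; have x0 := x_gt0; have x1 := x_lt1.
have A0 : 0 < A by rewrite -(pmulr_lgt0 _ lam0); lra.
have B0 : 0 < B by rewrite -(pmulr_lgt0 _ p_gt0); lra.
have m0 : 0 < u * q by rewrite mulr_gt0; lra.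
have q1 := q_lt1.
pose S c := ln (1 + w c).
pose I c := (Num.sqrt (1 + w c))^-1.
pose L c := ln (n - w c).
have -> : Ex P (fun c => (ln n - ln (n - w c)) / lam +
      ln (1 + w c) / p - A * (w c / n) + B / Num.sqrt (1 + w c)) =
    (ln n - Ex P L) / lam + Ex P S / p - A * (u * q / n) + B * Ex P I.
  rewrite -Ew (_ : (fun _ => _) = fun c => ln n / lam + (- lam^-1 * L c +
     (p^-1 * S c + (- A / n * w c + B * I c)))).
    rewrite (ExD P (fun=> _) (fun c => - lam^-1 * L c + _)) Ex_cst//.
    rewrite (ExD P (fun c => - lam^-1 * L c) (fun c => p^-1 * S c + _)) ExZ.
    rewrite (ExD P (fun c => p^-1 * S c) (fun c => - A / n * w c + _)) ExZ.
    rewrite (ExD P (fun c => - A / n * w c) (fun c => B * I c)) !ExZ.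
    ring.
  by apply/funext => c; rewrite /L /S /I; ring.
have Aq : A * (u * q / n) = A * (u / n) - A * ((1 - x) * (1 - q)).
  by rewrite [u]uE; field; lra.
have HL := Ex_ln_informed_le; rewrite -/L in HL.
have HS := Ex_ln1D_ge; rewrite -/S in HS.
have HI := Ex_inv_sqrt_ge; rewrite -/I in HI.
have a0 : 0 < Num.sqrt (1 + u * q) by rewrite sqrtr_gt0; lra.
(* This turns the error of order [x / n] in [ln q] into one of the same form as the fluctuation
   error. *)
have an : Num.sqrt (1 + u * q) <= n.
  have n0 : 0 <= n by lra.
  rewrite -[leRHS](ger0_norm n0) -sqrtr_sqr ler_sqrt ?sqr_ge0//.
  by rewrite expr2; nra.
have lnu : ln (1 + u) + ln q <= ln (1 + u * q).
  rewrite -lnM ?posrE; [|lra|lra].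
  by rewrite ler_ln ?posrE; [nra|rewrite mulr_gt0; lra|lra].
have BI := ler_wpM2l (ltW B0) HI.
have dge := d_ge.
have HL' : (ln n - Ex P L) / lam >=
    (ln n - ln (n - u)) / lam - (1 - x) - x * (1 - x) * p / lam.
  rewrite ler_pdivlMr// !mulrBl !divfK; lra.
have HLA : x * (1 - x) * p / lam <= A * ((1 - x) * (1 - q)).
  rewrite ler_pdivrMr//.
  have x1c : 0 <= 1 - x by lra.
  have x1' : 0 <= (1 - x) * (p * x) := mulr_ge0 x1c (ltW px_gt0).
  have := ler_wpM2r x1' HA.
  have Al0 : 0 <= A * lam * (1 - x) := mulr_ge0 (mulr_ge0 (ltW A0) (ltW lam0)) x1c.
  have := ler_wpM2l Al0 dge; lra.
move: (Num.sqrt (1 + u * q)) a0 an HS BI {HI} => a a0 an HS BI.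
have HS' : (ln (1 + u) + ln q - 2 * (1 - q) / a) / p <= Ex P S / p.
  by rewrite ler_wpM2r ?invr_ge0; lra.
suff : - x <= (ln q - 2 * (1 - q) / a) / p + B * ((1 - q) / (4 * a)).
  by rewrite Aq; move: HS' BI HL' HLA; rewrite !mulrBl !mulrDl; lra.
have H1 : - x - 4 * (1 - q) / a <= ln q / p.
  rewrite ler_pdivlMr//; apply: le_trans lnq.
  have : 2 * p ^+ 2 * x / n <= 4 * (1 - q) / a * p.
    rewrite ler_pdivrMr; last by lra.
    have -> : 4 * (1 - q) / a * p * n = 4 * (1 - q) * p * (n / a) by field; lra.
    apply: (@le_trans _ _ (4 * (1 - q) * p)).
      by have := ler_wpM2l (ltW p_gt0) dge; lra.
    by apply: ler_peMr; [apply: mulr_ge0; lra|rewrite ler_pdivlMr; lra].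
  lra.
have H2 : (4 * (1 - q) / a + 2 * (1 - q) / a / p) <= B * ((1 - q) / (4 * a)).
  have -> : B * ((1 - q) / (4 * a)) = (B * p) * ((1 - q) / (4 * a * p)) by field; lra.
  (* The errors add up to the coefficient [16 p + 8 <= 24], hence the constant in the hypothesis on
     [B]. *)
  have -> : 4 * (1 - q) / a + 2 * (1 - q) / a / p =
     (16 * p + 8) * ((1 - q) / (4 * a * p)) by field; lra.
  rewrite ler_wpM2r//; last by lra.
  by apply: divr_ge0; [lra|apply: mulr_ge0; lra].
rewrite mulrBl; lra.
Qed.

End Drift.

(** * A single round from a fixed informed set: mean and variance *)

Section Round.
Context {n : nat}.
Implicit Types (A B : {set 'I_n}) (c : {ffun 'I_n -> 'I_n * bool}) (v w : 'I_n).

Definition push_step A c : {set 'I_n} :=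
  (A :|: [set w | [exists v in A, c v == (w, true)]])%SET.

Lemma subset_push_step A c : A \subset push_step A c.
Proof. exact: finset.subsetUl. Qed.

Lemma push_stepT c : push_step [set: 'I_n] c = [set: 'I_n].
Proof. by apply/eqP; rewrite -finset.subTset subset_push_step. Qed.

(** Singletons [B] serve for the mean number of uninformed nodes, pairs for the second moment. *)
Definition misses A B c : bool :=
  [forall v, (v \in A) ==> ~~ ((c v).2 && ((c v).1 \in B))].

Lemma notin_push_step A c w :
  (w \in ~: push_step A c) = (w \in ~: A) && misses A [set w] c.
Proof.
rewrite !inE negb_or; congr (_ && _); rewrite negb_exists.
apply: eq_forallb => v; rewrite negb_and; case: (v \in A) => //=.
by case: (c v) => a b; rewrite inE xpair_eqE eqb_id andbC.
Qed.

Lemma misses2 A v w c :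
  misses A [set v; w] c = misses A [set v] c && misses A [set w] c.
Proof.
apply/forallP/andP => [H|[/forallP H1 /forallP H2] i].
  split; apply/forallP => i; apply/implyP => iA; move/implyP: (H i) => /(_ iA);
    rewrite !inE; apply: contra => /andP[-> ->]//=; exact: orbT.
apply/implyP => iA; move: (implyP (H1 i) iA) (implyP (H2 i) iA).
by rewrite !inE; case: (c i).2 => //=; rewrite negb_or => -> ->.
Qed.

(** Every new node is the target of a call from [A], and each node of [A] makes one call. *)
Lemma card_push_step_le A c : (#|push_step A c| <= #|A| + #|A|)%N.
Proof.
apply: leq_trans (leq_card_setU _ _) _; rewrite leq_add2l.
apply: leq_trans (leq_imset_card (fun v => (c v).1) A).
apply/subset_leq_card/fintype.subsetP => w; rewrite inE => /existsP[v /andP[vA /eqP cv]].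
by apply/imsetP; exists v => //; rewrite cv.
Qed.

Context {R : realType} (p : R).
Hypotheses (p_gt0 : 0 < p) (p_le1 : p <= 1) (n_gt1 : (1 < n)%N).

Definition call_weight (z : 'I_n * bool) : R := n%:R^-1 * bernoulli_pmf p z.2.

Definition round_weight c : R := \prod_v call_weight (c v).

Let n_gt0 : 0 < n%:R :> R.
Proof. by rewrite ltr0n ltnW. Qed.

Lemma call_weight_ge0 z : 0 <= call_weight z.
Proof.
by rewrite mulr_ge0 ?invr_ge0// bernoulli_pmf_ge0// (ltW p_gt0).
Qed.

Lemma round_weight_ge0 c : 0 <= round_weight c.
Proof. by apply: prodr_ge0 => v _; exact: call_weight_ge0. Qed.

Lemma sum_call_weight_hit B :
  \sum_z call_weight z * (~~ (z.2 && (z.1 \in B)))%:R = 1 - p / n%:R * #|B|%:R.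
Proof.
rewrite -(pair_bigA _ (fun v b => call_weight (v, b) * (~~ (b && (v \in B)))%:R))/=.
under eq_bigr => v _ do rewrite big_bool /call_weight /=.
have H v : n%:R^-1 * p * (v \notin B)%:R + n%:R^-1 * (1 - p) * 1%:R =
   n%:R^-1 - p / n%:R * (v \in B)%:R :> R.
  by case: (v \in B); rewrite /=; ring.
under eq_bigr => v _ do rewrite H.
rewrite big_split /= sumr_const card_ord sumrN -mulr_sumr -natr_sum -big_mkcond/=.
rewrite sum1_card -[n%:R^-1 *+ n]mulr_natl divff ?gt_eqF//.
Qed.

Lemma sum_call_weight : \sum_z call_weight z = 1.
Proof.
have := sum_call_weight_hit finset.set0; rewrite cards0 mulr0 subr0 => <-.
by apply: eq_bigr => z _; rewrite inE andbF mulr1.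
Qed.

Lemma sum_round_weight : \sum_c round_weight c = 1.
Proof.
rewrite -(bigA_distr_bigA (fun _ => call_weight)).
by rewrite big1// => v _; exact: sum_call_weight.
Qed.

(** The calls are independent, so the expectation is a product over all nodes: a node of [A]
    contributes the probability of not reaching [B], any other node contributes 1. *)
Lemma Ex_misses A B :
  Ex round_weight (fun c => (misses A B c)%:R) = (1 - p / n%:R * #|B|%:R) ^+ #|A|.
Proof.
pose F v z := call_weight z * ((v \in A) ==> ~~ (z.2 && (z.1 \in B)))%:R.
transitivity (\prod_v \sum_z F v z).
  rewrite bigA_distr_bigA; apply: eq_bigr => c _.
  rewrite big_split/=; congr (_ * _).
  rewrite /misses; case: forallP => [H|/forallP].
    by rewrite big1// => v _; rewrite H.
  rewrite negb_forall => /existsP[v /negbTE Hv].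
  by rewrite (bigD1 v)//= Hv mul0r.
rewrite (bigID (mem A))/= [X in _ * X]big1 ?mulr1; last first.
  move=> v /negbTE vA; rewrite -[RHS]sum_call_weight; apply: eq_bigr => z _.
  by rewrite /F vA mulr1.
rewrite -prodr_const; apply: eq_bigr => v vA.
by rewrite -sum_call_weight_hit; apply: eq_bigr => z _; rewrite /F vA.
Qed.

Let y : R := p / n%:R.

Let y_le : y <= 2^-1.
Proof.
have n2 : 2 <= n%:R :> R by rewrite ler_nat.
rewrite /y ler_pdivrMr//; move: p_le1; lra.
Qed.

Definition uninformed A c : R := #|~: push_step A c|%:R.

Lemma uninformedE A c :
  uninformed A c = \sum_(w in ~: A) (misses A [set w] c)%:R.
Proof.
rewrite /uninformed -sum1_card natr_sum (eq_bigl _ _ (notin_push_step A c)).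
by rewrite big_mkcondr; apply: eq_bigr => w _; case: ifP.
Qed.

Lemma Ex_sum (I : finType) (Q : pred I) (F : I -> {ffun 'I_n -> 'I_n * bool} -> R) :
  Ex round_weight (fun c => \sum_(i | Q i) F i c) =
  \sum_(i | Q i) Ex round_weight (F i).
Proof.
rewrite /Ex exchange_big/=; apply: eq_bigr => c _; exact: mulr_sumr.
Qed.

Lemma Ex_uninformed A :
  Ex round_weight (uninformed A) = #|~: A|%:R * (1 - y) ^+ #|A|.
Proof.
rewrite (_ : uninformed A = fun c => \sum_(w in ~: A) (misses A [set w] c)%:R).
  rewrite Ex_sum (eq_bigr (fun=> (1 - y) ^+ #|A|)).
    by rewrite sumr_const mulr_natl.
  by move=> w _; rewrite Ex_misses cards1 mulr1.
by apply/funext => c; exact: uninformedE.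
Qed.

(** Expansion over pairs of nodes: the diagonal gives [q], and for distinct nodes
    [(1 - 2 y) ^ k <= (1 - y) ^ (2 k)] with [k = #|A|], a negative correlation. *)
Lemma Ex_uninformed_sqr A (q := (1 - y) ^+ #|A|) :
  Ex round_weight (fun c => uninformed A c ^+ 2) <=
  #|~: A|%:R * q + #|~: A|%:R * (#|~: A|%:R - 1) * q ^+ 2.
Proof.
have yle := y_le.
have q2 v w : v != w ->
    Ex round_weight (fun c => (misses A [set v] c)%:R * (misses A [set w] c)%:R) <= q ^+ 2.
  move=> vw; under [X in Ex _ X]funext => c do rewrite -natrM mulnb -misses2.
  rewrite Ex_misses cards2 vw /= /q exprAC lerXn2r ?nnegrE ?sqr_ge0//.
    by rewrite -/y; lra.
  by rewrite -/y expr2; have := sqr_ge0 y; lra.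
rewrite (_ : (fun c => _) = fun c => \sum_(v in ~: A) \sum_(w in ~: A)
    ((misses A [set v] c)%:R * (misses A [set w] c)%:R)); last first.
  by apply/funext => c; rewrite uninformedE expr2 big_distrlr.
rewrite Ex_sum.
apply: (@le_trans _ _ (\sum_(v in ~: A) (q + (#|~: A|%:R - 1) * q ^+ 2))); last first.
  by rewrite sumr_const -[leLHS]mulr_natl mulrDr mulrA.
apply: ler_sum => v vA; rewrite Ex_sum (bigD1 v)//= lerD//.
  under [X in Ex _ X]funext => c do rewrite -natrM mulnb andbb.
  by rewrite Ex_misses cards1 mulr1.
apply: (@le_trans _ _ (\sum_(w in ~: A | w != v) q ^+ 2)).
  by apply: ler_sum => w /andP[_ wv]; rewrite q2// eq_sym.
rewrite (_ : #|~: A|%:R - 1 = #|[pred w in ~: A | w != v]|%:R).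
  by rewrite sumr_const mulr_natl.
rewrite (cardD1 v) vA natrD addrAC subrr add0r; congr (_%:R).
by apply: eq_card => w; rewrite !inE andbC.
Qed.

Lemma Var_uninformed A (q := (1 - y) ^+ #|A|) :
  Ex round_weight
    (fun c => (uninformed A c - Ex round_weight (uninformed A)) ^+ 2) <=
  #|~: A|%:R * q * (1 - q).
Proof.
set m := Ex _ (uninformed A).
rewrite (_ : (fun c => _) = fun c => uninformed A c ^+ 2 +
    (- (2 * m) * uninformed A c + m ^+ 2)); last by apply/funext => c; ring.
rewrite (ExD _ _ (fun c => - (2 * m) * uninformed A c + m ^+ 2)).
rewrite (ExD _ (fun c => - (2 * m) * uninformed A c) (fun=> m ^+ 2)).
rewrite ExZ Ex_cst ?sum_round_weight// -/m.
rewrite (_ : m = #|~: A|%:R * q); last exact: Ex_uninformed.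
apply: le_trans (lerD (Ex_uninformed_sqr A) (lexx _)) _; rewrite -/q.
by move: q #|~: A|%:R => q u; rewrite le_eqVlt; apply/orP; left; apply/eqP; ring.
Qed.

End Round.

Local Open Scope classical_set_scope.
Local Open Scope ring_scope.

(** * Probabilities of events determined by a finite-valued variable *)

Section FiniteValued.
Context {d} {Omega : measurableType d} {R : realType} (P : probability Omega R).
Context {Z : finType} (Y : Omega -> Z).
Hypothesis mY : forall z, measurable (Y @^-1` [set z]).

Definition Pr (E : set Omega) : R := fine (P E).

Lemma PrE E : measurable E -> P E = (Pr E)%:E.
Proof. by move=> mE; rewrite /Pr fineK// fin_num_measure. Qed.

Lemma Pr_ge0 E : 0 <= Pr E.
Proof. by rewrite fine_ge0. Qed.

Lemma Pr_total E : measurable E ->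
  Pr E = \sum_z Pr (E `&` Y @^-1` [set z]).
Proof.
move=> mE; apply: EFin_inj; rewrite -PrE// -sumEFin.
have EU : E = \bigcup_(z in [set: Z]) (E `&` Y @^-1` [set z]).
  by apply/seteqP; split => [x Ex|x [z _ []]//]; exists (Y x).
rewrite {1}EU measure_fin_bigcup//; last 2 first.
- by move=> z1 z2 _ _ [x [[_ <-] [_ <-]]].
- by move=> z _; exact: measurableI.
rewrite (@fsbigE _ _ _ _ _ (index_enum Z))//.
- apply: eq_big => [z|z _]; first exact: mem_set.
  by rewrite -PrE//; exact: measurableI.
- exact: index_enum_uniq.
- by move=> z _; rewrite mem_index_enum.
- exact: finite_finset.
Qed.

Lemma measurable_finType_preimage (Q : set Z) : measurable (Y @^-1` Q).
Proof.
have -> : Y @^-1` Q = \bigcup_(z in Q) (Y @^-1` [set z]).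
  by apply/seteqP; split => [x Qx|x /= [z Qz ->]//]; exists (Y x).
by apply: fin_bigcup_measurable => //; exact: finite_finset.
Qed.

End FiniteValued.

(** * The informed set as a Markov chain, and the spreading time as a series *)

Section MarkovProperty.
Context {d} {Omega : measurableType d} {R : realType} {P : probability Omega R}.
Context {p : R} {n : nat} {call : nat * 'I_n -> Omega -> 'I_n * bool} {v0 : 'I_n}.
Hypothesis calls : push_calls P p call.
Implicit Types (A : {set 'I_n}) (t : nat).

Local Notation informed := (informed call v0).

Definition round_calls t x : {ffun 'I_n -> 'I_n * bool} :=
  [ffun v => call (t, v) x].

Lemma informedS t x : informed t.+1 x = push_step (informed t x) (round_calls t x).
Proof.
congr (_ :|: _)%SET; apply/setP => w; rewrite !inE.
by apply: eq_existsb => v; rewrite ffunE.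
Qed.

Lemma informed_v0 t x : v0 \in informed t x.
Proof.
elim: t => [|t IH]; first by rewrite inE.
by rewrite informedS (fintype.subsetP (subset_push_step _ _)).
Qed.

Lemma round_calls_preimage t c : round_calls t @^-1` [set c] =
  \bigcap_(v in [set: 'I_n]) call (t, v) @^-1` [set c v].
Proof.
apply/seteqP; split => x /=; first by move=> <- v _; rewrite /= ffunE.
by move=> H; apply/ffunP => v; rewrite ffunE; exact: H.
Qed.

Lemma measurable_round_calls t c : measurable (round_calls t @^-1` [set c]).
Proof.
rewrite round_calls_preimage; apply: fin_bigcap_measurable => // v _.
exact: call_measurable calls _ _.
Qed.

Let state t x := (informed t x, round_calls t x).

Let measurable_state t :
  (forall A, measurable (informed t @^-1` [set A])) ->
  forall z, measurable (state t @^-1` [set z]).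
Proof.
move=> mt [A c]; have -> : state t @^-1` [set (A, c)] =
    informed t @^-1` [set A] `&` round_calls t @^-1` [set c].
  by apply/seteqP; split => x; [case=> <- <-|case=> /= <- <-].
by apply: measurableI => //; exact: measurable_round_calls.
Qed.

Lemma measurable_informed t A : measurable (informed t @^-1` [set A]).
Proof.
elim: t A => [|t IH] A.
  have [->|nA] := eqVneq A [set v0]%SET.
    by rewrite (_ : _ @^-1` _ = setT)//; apply/seteqP; split.
  rewrite (_ : _ @^-1` _ = set0)//; apply/seteqP; split => // x /= /esym/eqP.
  by rewrite (negbTE nA).
have -> : informed t.+1 @^-1` [set A] =
    state t @^-1` [set z | push_step z.1 z.2 = A].
  by apply/seteqP; split => x /=; rewrite -informedS.
exact: measurable_finType_preimage (measurable_state t IH) _.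
Qed.

Definition call_event (s : seq (nat * 'I_n)) (B : nat * 'I_n -> set ('I_n * bool)) :=
  \bigcap_(i in [set` s]) call i @^-1` B i.

Lemma measurable_call_event s B : measurable (call_event s B).
Proof.
apply: fin_bigcap_measurable => [|i _]; first exact: finite_seq.
exact: call_measurable calls _ _.
Qed.

Lemma Pr_call_event s B : uniq s ->
  Pr P (call_event s B) = \prod_(i <- s) Pr P (call i @^-1` B i).
Proof.
move=> us; apply: EFin_inj.
rewrite -PrE; last exact: measurable_call_event.
have ps : perm_eq (seq_fset tt s) s.
  by apply: perm_trans (seq_fset_perm _ _) _; rewrite undup_id.
have -> : call_event s B = \bigcap_(i in [set` seq_fset tt s]) call i @^-1` B i.
  apply: eq_bigcapl; split => i; rewrite /mkset.
    by rewrite (seq_fsetE tt s i).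
  by rewrite (seq_fsetE tt s i).
rewrite (call_independent calls) (perm_big _ ps)/= -prodEFin.
by apply: eq_bigr => i _; rewrite PrE//; exact: call_measurable calls _ _.
Qed.

Lemma Pr_call i z : Pr P (call i @^-1` [set z]) = call_weight p z.
Proof. by case: z => w b; rewrite /Pr (call_law calls). Qed.

Let round_seq t : seq (nat * 'I_n) := [seq (t, v) | v <- enum 'I_n].

(** The law after one more round, with the informed set and the calls of the round weighted as
    independent. *)
Definition transition t A : R :=
  \sum_z (push_step z.1 z.2 == A)%:R *
    (Pr P (informed t @^-1` [set z.1]) * round_weight p z.2).

(** [informed t] is a function of the calls with first index below [t]. Any finite list of later
    calls is allowed, not only those of one round, so that the induction on [t] goes through. *)
Definition indep_future t : Prop := forall A s B,
  uniq s -> (forall i, i \in s -> (t <= i.1)%N) ->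
  Pr P (informed t @^-1` [set A] `&` call_event s B) =
  Pr P (informed t @^-1` [set A]) * Pr P (call_event s B).

(** After splitting by the informed set and the calls of index [t], each piece is an event about
    [informed t] and a longer list of calls, to which the independence at [t] applies. *)
Let transition_call_event t : indep_future t -> forall A s B,
  uniq s -> (forall i, i \in s -> (t < i.1)%N) ->
  Pr P (informed t.+1 @^-1` [set A] `&` call_event s B) =
  transition t A * Pr P (call_event s B).
Proof.
move=> indep A s B us ts.
rewrite (Pr_total P (state t) (measurable_state t (measurable_informed t)));
  last by apply: measurableI; [exact: measurable_informed|exact: measurable_call_event].
rewrite mulr_suml; apply: eq_bigr => -[A' c] _ /=.
have [stepA|stepA] := eqVneq (push_step A' c) A; last first.
  rewrite mul0r mul0r (_ : _ `&` _ = set0) ?/Pr ?measure0//.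
  apply/seteqP; split => // x [[At _] [H1 H2]]; have := informedS t x.
  by rewrite H1 H2 [LHS]At => /esym/eqP; rewrite (negbTE stepA).
(* [B'] fixes the calls of index [t] to [c] and keeps [B] on [s]; the strict bound [t < i.1] makes
   the two lists disjoint. *)
pose B' (i : nat * 'I_n) := if i.1 == t then [set c i.2] else B i.
have ndisj i : i \in s -> i.1 != t by move=> /ts; case: ltngtP.
have us' : uniq (round_seq t ++ s).
  rewrite cat_uniq us map_inj_uniq ?enum_uniq ?andbT//=; last by move=> ? ? [].
  apply/hasPn => i /ndisj it; apply/negP => /mapP[v _ iE].
  by move: it; rewrite iE eqxx.
have -> : informed t.+1 @^-1` [set A] `&` call_event s B `&` state t @^-1` [set (A', c)]
    = informed t @^-1` [set A'] `&` call_event (round_seq t ++ s) B'.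
  apply/seteqP; split => x.
    move=> [[_ Bx] [H1 H2]]; split => // i /=; rewrite mem_cat => /orP[|si].
      by move=> /mapP[v _ ->] /=; rewrite /B'/= eqxx -H2 ffunE.
    by rewrite /B' (negbTE (ndisj i si)); exact: Bx.
  move=> [/= H1 Bx]; have H2 : round_calls t x = c.
    apply/ffunP => v; rewrite ffunE.
    have := Bx (t, v); rewrite /B' /= eqxx; apply.
    by rewrite mem_cat map_f ?mem_enum.
  split; last by rewrite /state /= H1 H2.
  split; first by change (informed t.+1 x = A); rewrite informedS H1 H2.
  move=> i /= si; have := Bx i; rewrite /B' /= (negbTE (ndisj i si)); apply.
  by rewrite mem_cat si orbT.
rewrite indep//; last first.
  by move=> i; rewrite mem_cat => /orP[/mapP[v _ ->]//|/ts/ltnW].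
rewrite mul1r -mulrA; congr (_ * _).
rewrite !Pr_call_event// big_cat/=; congr (_ * _).
  rewrite big_map big_enum/=; apply: eq_bigr => v _.
  by rewrite /B' /= eqxx Pr_call.
by apply: eq_big_seq => i si; rewrite /B' (negbTE (ndisj i si)).
Qed.

Let transition_indep t : indep_future t -> forall A,
  Pr P (informed t.+1 @^-1` [set A]) = transition t A.
Proof.
move=> /transition_call_event H A.
have := H A [::] (fun=> setT) isT (fun i => fun e => ltac:(by [])).
have -> : call_event [::] (fun=> setT) = setT by apply/seteqP; split.
by rewrite setIT {2}/Pr probability_setT mulr1.
Qed.

Lemma Pr_informed_indep t : indep_future t.
Proof.
elim: t => [|t IH] A s B us ts; last first.
  by rewrite transition_indep// transition_call_event.
have [->|nA] := eqVneq A [set v0]%SET.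
  rewrite (_ : _ @^-1` _ = setT); last by apply/seteqP; split.
  by rewrite setTI {2}/Pr probability_setT mul1r.
rewrite (_ : _ @^-1` _ = set0); last first.
  apply/seteqP; split => // x /= /esym/eqP.
  by rewrite (negbTE nA).
by rewrite set0I /Pr measure0 mul0r.
Qed.

Lemma Pr_informedS t A : Pr P (informed t.+1 @^-1` [set A]) = transition t A.
Proof. exact/transition_indep/Pr_informed_indep. Qed.

Definition mean t (f : {set 'I_n} -> R) : R :=
  \sum_A Pr P (informed t @^-1` [set A]) * f A.

Lemma mean0 f : mean 0 f = f [set v0]%SET.
Proof.
rewrite /mean (bigD1 [set v0]%SET)//= [X in _ + X]big1 ?addr0.
  rewrite (_ : _ @^-1` _ = setT); last by apply/seteqP; split.
  by rewrite /Pr probability_setT mul1r.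
move=> A nA; rewrite (_ : _ @^-1` _ = set0) ?/Pr ?measure0 ?mul0r//.
by apply/seteqP; split => // x /= /esym/eqP; rewrite (negbTE nA).
Qed.

Lemma meanS t f :
  mean t.+1 f = mean t (fun A => Ex (round_weight p) (fun c => f (push_step A c))).
Proof.
rewrite /mean; under eq_bigr => A _ do rewrite Pr_informedS /transition mulr_suml.
rewrite exchange_big/=.
under [RHS]eq_bigr => A _ do rewrite /Ex mulr_sumr.
rewrite [RHS]pair_bigA; apply: eq_bigr => -[A c] _ /=.
rewrite (bigD1 (push_step A c))//= eqxx mul1r [X in _ + X]big1 ?addr0 ?mulrA//.
by move=> A' nA'; rewrite eq_sym (negbTE nA') !mul0r.
Qed.

Lemma mean_cst t a : mean t (fun=> a) = a.
Proof.
rewrite /mean -mulr_suml.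
have := Pr_total P (informed t) (measurable_informed t) setT measurableT.
under eq_bigr do rewrite setTI.
by move=> <-; rewrite /Pr probability_setT mul1r.
Qed.

(** Sets without [v0] have probability zero. This confines the drift conditions to nonempty informed
    sets. *)
Lemma le_mean t f g : (forall A, v0 \in A -> f A <= g A) -> mean t f <= mean t g.
Proof.
move=> fg; apply: ler_sum => A _.
have [vA|vA] := boolP (v0 \in A); first by rewrite ler_wpM2l ?Pr_ge0 ?fg.
rewrite (_ : _ @^-1` _ = set0) ?/Pr ?measure0 ?mul0r//.
apply/seteqP; split => // x /= xA.
by move: vA; rewrite -xA informed_v0.
Qed.

Lemma meanD t f g : mean t (fun A => f A + g A) = mean t f + mean t g.
Proof. by rewrite /mean -big_split; apply: eq_bigr => A _; rewrite mulrDr. Qed.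

Lemma meanZ t a f : mean t (fun A => a * f A) = a * mean t f.
Proof. by rewrite /mean mulr_sumr; apply: eq_bigr => A _; rewrite mulrCA. Qed.

Definition unfinished (A : {set 'I_n}) : R := (A != [set: 'I_n]%SET)%:R.

Lemma mean_unfinished t :
  mean t unfinished = Pr P (informed t @^-1` [set~ [set: 'I_n]%SET]).
Proof.
have mQ := measurable_finType_preimage _ (measurable_informed t).
rewrite (Pr_total P (informed t) (measurable_informed t)); last exact: mQ.
apply: eq_bigr => A _; rewrite /unfinished; have [->|nA] := eqVneq A [set: 'I_n]%SET.
  rewrite mulr0 (_ : _ `&` _ = set0) ?/Pr ?measure0//.
  by apply/seteqP; split => // x [].
rewrite mulr1; congr (Pr P _); apply/seteqP; split => [x /= xA|x []//].
by split => //=; rewrite xA; exact/eqP.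
Qed.

Lemma informed_setT t s x : (t <= s)%N ->
  informed t x = [set: 'I_n]%SET -> informed s x = [set: 'I_n]%SET.
Proof.
move=> + tT; elim: s => [|s IH]; first by rewrite leqn0 => /eqP <-.
rewrite leq_eqVlt => /predU1P[<-//|/IH sT].
by rewrite informedS sT push_stepT.
Qed.

(** Once complete, the informed set stays complete, so the first complete time is the number of
    incomplete times. Without completion both sides are infinite. *)
Lemma spreading_time_series x : spreading_time R call v0 x =
  (\sum_(0 <= t <oo) (unfinished (informed t x))%:E)%E.
Proof.
rewrite /spreading_time.
have u0 t : (0 <= (unfinished (informed t x))%:E)%E by rewrite lee_fin /unfinished.
have [xT|xnT] := pselect (exists t, informed t x == [set: 'I_n]%SET); last first.
  transitivity (+oo : \bar R)%E.
    rewrite (_ : [set _ | _ in _] = set0) ?ereal_inf0//.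
    by apply/seteqP; split => // _ [t /= xt _]; apply: xnT; exists t; apply/eqP.
  apply/esym/eqyP => r r0.
  apply: le_trans (nneseries_lim_ge (Num.bound r) (fun t _ _ => u0 t)).
  under eq_bigr => t _.
    rewrite /unfinished (_ : _ != _); last by apply/negP => xt; apply: xnT; exists t.
    over.
  by rewrite sumEFin lee_fin sumr_const_nat subn0 ltW// archi_boundP// ltW.
have := ex_minnP xT; case=> T /eqP TT Tmin.
transitivity (T%:R%:E : \bar R).
  apply/eqP; rewrite eq_le; apply/andP; split.
    by apply: ereal_inf_lbound; exists T.
  by apply: le_ereal_inf_tmp => _ [t /= /eqP /Tmin Tt <-]; rewrite lee_fin ler_nat.
rewrite (nneseries_split _ T)// eseries0 ?adde0; last first.
  move=> t Tt _; rewrite add0n in Tt.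
  by rewrite /unfinished (informed_setT _ _ _ Tt TT) eqxx.
rewrite add0n big_nat (eq_bigr (fun=> 1%:E)).
  by rewrite -big_nat sumEFin sumr_const_nat subn0.
move=> t /andP[_ tT]; rewrite /unfinished (_ : _ != _)//.
by apply/negP => /Tmin; rewrite leqNgt tT.
Qed.

(** The integral is exchanged with the series of nonnegative indicators, so only the laws of the
    individual informed sets matter. *)
Lemma expected_spreading_timeE : expected_spreading_time P call v0 =
  (\sum_(0 <= t <oo) (mean t unfinished)%:E)%E.
Proof.
have mQ t : measurable (informed t @^-1` [set~ [set: 'I_n]%SET]).
  exact: measurable_finType_preimage (measurable_informed t) _.
rewrite /expected_spreading_time.
under eq_integral => x _.
  rewrite spreading_time_series; under eq_eseriesr => t _.
    rewrite (_ : unfinished _ = \1_(informed t @^-1` [set~ [set: 'I_n]%SET]) x).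
      over.
    rewrite /unfinished indicE; congr ((nat_of_bool _)%:R).
    apply/idP/idP => [/eqP ?|]; first exact: mem_set.
    by move=> /set_mem/eqP.
  over.
rewrite integral_nneseries//; last first.
  move=> t; apply/measurable_EFinP; exact: measurable_indic (mQ t).
apply: eq_eseriesr => t _; rewrite integral_indic// setIT mean_unfinished -PrE//.
Qed.

End MarkovProperty.

Arguments mean {d Omega R} P {n} call v0 t f.

(** * Drift of the potentials under a round of the protocol *)

Section RoundDrift.
Context {R : realType} (p : R) (n : nat) (A : {set 'I_n}) (v0 : 'I_n).
Hypotheses (p_gt0 : 0 < p) (p_le1 : p <= 1) (n_gt1 : (1 < n)%N).
Hypotheses (v0A : v0 \in A) (AnT : A != [set: 'I_n]%SET).

Let k : R := #|A|%:R.
Let u : R := #|~: A|%:R.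
Let y : R := p / n%:R.
Let q : R := (1 - y) ^+ #|A|.

Let ku : n%:R - u = k.
Proof.
by rewrite -[n in n%:R]card_ord -(cardsC A) natrD addrK.
Qed.

Let n_ge2 : 2 <= n%:R :> R.
Proof. by rewrite ler_nat. Qed.

Let k_ge1 : 1 <= k.
Proof. by rewrite ler1n card_gt0; apply/set0Pn; exists v0. Qed.

Let u_ge1 : 1 <= u.
Proof.
rewrite ler1n card_gt0; apply: contra AnT => /eqP AC.
by rewrite -(finset.setCK A) AC finset.setC0.
Qed.

Let u_le : u <= n%:R - 1.
Proof. by move: k_ge1; rewrite -ku; lra. Qed.

Let w_ge0 c : 0 <= uninformed A c :> R.
Proof. by []. Qed.

Let w_le c : uninformed A c <= u.
Proof. by rewrite ler_nat subset_leq_card// finset.setCS subset_push_step. Qed.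

Let w_ge c : u - uninformed A c <= n%:R - u.
Proof.
rewrite ku /uninformed /u.
have := card_push_step_le A c; rewrite -(ler_nat R) natrD.
have : n%:R = #|~: push_step A c|%:R + #|push_step A c|%:R :> R.
  by rewrite -natrD addnC cardsC card_ord.
have := ku; rewrite /k /u.
move: (#|A|%:R : R) (#|~: A|%:R : R) (#|push_step A c|%:R : R).
move: (#|~: push_step A c|%:R : R) (n%:R : R) => *; lra.
Qed.

Let y_gt0 : 0 < y.
Proof. by rewrite divr_gt0// ltr0n ltnW. Qed.

Let y_le : y <= 2^-1.
Proof. by rewrite ler_pdivrMr ?ltr0n 1?ltnW//; move: n_ge2 p_le1; lra. Qed.

Let kyE : k * y = p * ((n%:R - u) / n%:R).
Proof. by rewrite ku /y mulrCA. Qed.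

Let q_gt0 : 0 < q.
Proof. exact: expr1B_gt0. Qed.

Let q_le : q * (1 + p * ((n%:R - u) / n%:R)) <= 1.
Proof. by rewrite -kyE; exact: expr1B_le. Qed.

Let q_ge : 1 - p * ((n%:R - u) / n%:R) <= q.
Proof. by rewrite -kyE; exact: expr1B_ge. Qed.

Let Ew : Ex (round_weight p) (uninformed A) = u * q.
Proof. exact: Ex_uninformed. Qed.

Let Vw : Ex (round_weight p) (fun c =>
  (uninformed A c - Ex (round_weight p) (uninformed A)) ^+ 2) <= u * q * (1 - q).
Proof. exact: Var_uninformed. Qed.

Lemma round_potential_upper_le (K B C : R) :
  2 * expR 1 <= K -> 24 <= B * p * ln (1 + p) -> 8 <= C * p * ln (1 + p) ->
  Ex (round_weight p)
    (fun c => potential_upper p n%:R K B C #|~: push_step A c|%:R) <=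
  potential_upper p n%:R K B C u - 1.
Proof.
move=> HK HB HC.
apply: (Ex_potential_upper_le (round_weight p) (uninformed A) p n%:R u q) => //.
- exact: round_weight_ge0.
- exact: sum_round_weight.
- by rewrite -kyE; exact: ln_expr1B_le.
(* While some node is uninformed, [k <= n - 1], hence [k p <= n - p] and [q >= 1 / e]; so [K >= 2 e]
   gives [K q >= 2]. *)
have : expR (-1) <= q.
  apply: expr1B_ge_expRN1 => //; rewrite -/k /y.
  rewrite mulrA ler_pdivrMr ?ltr0n 1?ltnW// mulrBl divfK; last first.
    by rewrite pnatr_eq0 -lt0n ltnW.
  have := u_ge1; have := ku; have := p_gt0; have := p_le1; have := k_ge1; nra.
rewrite expRN => eq.
have e0 := expR_gt0 (1 : R).
have : 2 * expR 1 * (expR 1)^-1 <= K * q.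
  by rewrite ler_pM// ?mulr_ge0 ?invr_ge0 ?ltW.
by rewrite mulfK// gt_eqF.
Qed.

Lemma round_potential_lower_ge (B C : R) :
  2 <= B * ln (1 + p) -> 24 <= C * p ->
  potential_lower p n%:R B C u - 1 <=
  Ex (round_weight p)
    (fun c => potential_lower p n%:R B C #|~: push_step A c|%:R).
Proof.
move=> HB HC.
apply: (Ex_potential_lower_ge (round_weight p) (uninformed A) p n%:R u q) => //.
- exact: round_weight_ge0.
- exact: sum_round_weight.
apply: le_trans (ln_expr1B_ge y_gt0 y_le _).
rewrite le_eqVlt; apply/orP; left; apply/eqP; rewrite -/k -kyE ku /y.
by field; rewrite pnatr_eq0 -lt0n ltnW.
Qed.

End RoundDrift.

(** * From drift to bounds on the expected spreading time *)

Section PotentialMethod.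
Context {d} {Omega : measurableType d} {R : realType} {P : probability Omega R}.
Context {p : R} {n : nat} {call : nat * 'I_n -> Omega -> 'I_n * bool} {v0 : 'I_n}.
Hypotheses (calls : push_calls P p call) (n_gt1 : (1 < n)%N).
Implicit Type A : {set 'I_n}.

Local Notation mean := (mean P call v0).

Let Ex_push_stepT (f : {set 'I_n} -> R) :
  Ex (round_weight p) (fun c => f (push_step [set: 'I_n]%SET c)) = f [set: 'I_n]%SET.
Proof.
rewrite (_ : (fun c => _) = fun=> f [set: 'I_n]%SET).
  by rewrite Ex_cst ?sum_round_weight.
by apply/funext => c; rewrite push_stepT.
Qed.

Lemma mean_unfinished_ge0 t : 0 <= mean t unfinished.
Proof. by rewrite -(mean_cst (v0 := v0) calls t 0) le_mean// => A _; rewrite /unfinished. Qed.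

(** Telescoping: from an incomplete set a round costs [f] at least 1 on average; at the full set,
    which is absorbing, neither the count nor [f] changes. *)
Lemma sum_unfinished_le (f : {set 'I_n} -> R) (N : nat) :
  (forall A, v0 \in A -> A != [set: 'I_n]%SET ->
    Ex (round_weight p) (fun c => f (push_step A c)) <= f A - 1) ->
  \sum_(t < N) mean t unfinished + mean N f <= f [set v0]%SET.
Proof.
move=> drift; elim: N => [|N IH]; first by rewrite big_ord0 add0r mean0.
rewrite big_ord_recr/=; apply: le_trans IH; rewrite -addrA lerD2l.
rewrite (meanS calls) -meanD; apply: le_mean => A vA.
have [->|AT] := eqVneq A [set: 'I_n]%SET.
  by rewrite /unfinished eqxx add0r Ex_push_stepT.
by rewrite /unfinished AT -lerBrDl; exact: drift.
Qed.

Lemma sum_unfinished_ge (g : {set 'I_n} -> R) (N : nat) :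
  (forall A, v0 \in A -> A != [set: 'I_n]%SET ->
    g A - 1 <= Ex (round_weight p) (fun c => g (push_step A c))) ->
  g [set v0]%SET <= \sum_(t < N) mean t unfinished + mean N g.
Proof.
move=> drift; elim: N => [|N IH]; first by rewrite big_ord0 add0r mean0.
rewrite big_ord_recr/=; apply: le_trans IH _; rewrite -addrA lerD2l.
rewrite (meanS calls) -meanD; apply: le_mean => A vA.
have [->|AT] := eqVneq A [set: 'I_n]%SET.
  by rewrite /unfinished eqxx add0r Ex_push_stepT.
by rewrite /unfinished AT -lerBlDl; exact: drift.
Qed.

Let series_ge (N : nat) : ((\sum_(t < N) mean t unfinished)%:E <=
  expected_spreading_time P call v0)%E.
Proof.
rewrite (expected_spreading_timeE calls) -sumEFin.
rewrite -(big_mkord xpredT (fun t => (mean t unfinished)%:E)).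
by apply: nneseries_lim_ge => t _ _; rewrite lee_fin mean_unfinished_ge0.
Qed.

Lemma expected_spreading_time_le (f : {set 'I_n} -> R) :
  (forall A, v0 \in A -> 0 <= f A) ->
  (forall A, v0 \in A -> A != [set: 'I_n]%SET ->
    Ex (round_weight p) (fun c => f (push_step A c)) <= f A - 1) ->
  (expected_spreading_time P call v0 <= (f [set v0]%SET)%:E)%E.
Proof.
move=> f0 drift; rewrite (expected_spreading_timeE calls).
apply: lime_le.
  by apply: is_cvg_nneseries => t _ _; rewrite lee_fin mean_unfinished_ge0.
apply: nearW => N; rewrite big_mkord sumEFin lee_fin.
apply: le_trans (sum_unfinished_le f N drift); rewrite lerDl.
by rewrite -(mean_cst (v0 := v0) calls N 0) le_mean.
Qed.

(** The remainder [mean N g] exceeds the final value of [g] by at most [M * mean N unfinished]. One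
    [N] for which this is at most 1 suffices, at the price of the slack 1. *)
Lemma expected_spreading_time_ge (g : {set 'I_n} -> R) :
  (forall A, v0 \in A -> A != [set: 'I_n]%SET ->
    g A - 1 <= Ex (round_weight p) (fun c => g (push_step A c))) ->
  ((g [set v0]%SET - g [set: 'I_n]%SET - 1)%:E <=
    expected_spreading_time P call v0)%E.
Proof.
move=> drift; set gT := g [set: 'I_n]%SET.
pose M : R := \sum_A `|g A - gT|.
have M0 : 0 <= M by apply: sumr_ge0.
have mean_g N : mean N g <= gT + M * mean N unfinished.
  rewrite -meanZ -{1}(mean_cst (v0 := v0) calls N gT) -meanD; apply: le_mean => A _.
  rewrite /unfinished; have [->|_] := eqVneq A [set: 'I_n]%SET; first by rewrite mulr0 addr0.
  rewrite mulr1 -lerBlDl; apply: le_trans (ler_norm _) _.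
  by rewrite /M (bigD1 A)//= lerDl sumr_ge0.
(* Otherwise the terms of the series stay above 1 / M and its sum is infinite. *)
have [[N MN]|noN] := pselect (exists N, M * mean N unfinished <= 1).
  apply: le_trans (series_ge N); rewrite lee_fin.
  by have := sum_unfinished_ge g N drift; have := mean_g N; lra.
have M_ge N : 1 <= M * mean N unfinished.
  by rewrite leNgt; apply/negP => /ltW ?; apply: noN; exists N.
suff -> : expected_spreading_time P call v0 = +oo%E by exact: leey.
apply/eqyP => r r0.
have Mr : 0 <= M * r by rewrite mulr_ge0// ltW.
apply: le_trans (series_ge (Num.bound (M * r))); rewrite lee_fin.
have Mpos : 0 < M.
  by rewrite lt0r M0 andbT; apply: contraTneq (M_ge 0%N) => ->; rewrite mul0r ler10.
rewrite -(ler_pM2l Mpos) mulr_sumr; apply: le_trans (ltW (archi_boundP Mr)) _.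
have -> : (Num.bound (M * r))%:R = \sum_(t < Num.bound (M * r)) 1 :> R.
  by rewrite sumr_const card_ord.
by apply: ler_sum.
Qed.

End PotentialMethod.

(** * Choice of the constants and evaluation of the potentials at the start and at the end *)

Theorem theorem54 (R : realType) (p : R) (hp0 : 0 < p) (hp1 : p <= 1) :
  exists (C : R) (N : nat),
    forall (n : nat), (N <= n)%N ->
    forall (d : measure_display) (Omega : measurableType d)
           (P : probability Omega R)
           (call : nat * 'I_n -> Omega -> 'I_n * bool) (v0 : 'I_n),
      push_calls P p call ->
      (`| expected_spreading_time P call v0
          - (ln (n%:R : R) / ln (1 + p) + p^-1 * ln (n%:R : R))%:E |
        <= C%:E)%E.
Proof.
have lam0 : 0 < ln (1 + p) by rewrite ln_gt0; lra.
(* These values meet the requirements of the one-round bounds with equality. *)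
pose K : R := 2 * expR 1.
pose A : R := 24 / (p * ln (1 + p)).
pose B : R := 8 / (p * ln (1 + p)).
pose A' : R := 2 / ln (1 + p).
pose B' : R := 24 / p.
have pl : 0 < p * ln (1 + p) by rewrite mulr_gt0.
have K0 : 0 <= K by rewrite mulr_ge0// ltW// expR_gt0.
have A0 : 0 <= A by rewrite divr_ge0// ltW.
have B0 : 0 <= B by rewrite divr_ge0// ltW.
have A'0 : 0 <= A' by rewrite divr_ge0// ltW.
have B'0 : 0 <= B' by rewrite divr_ge0// ltW.
(* The constant adds the two one-sided errors; [n >= 2] ensures [p / n <= 1 / 2]. *)
exists (K / p + A + B + A' + B' + 1), 2%N => n n2 d Omega P call v0 calls.
have nR : 2 <= n%:R :> R by rewrite ler_nat.
have cardC (S : {set 'I_n}) : n%:R - #|~: S|%:R = #|S|%:R :> R.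
  by rewrite -[n in n%:R]card_ord -(cardsC S) natrD addrK.
have card1 : #|~: [set v0]%SET|%:R = n%:R - 1 :> R.
  by have := cardC [set v0]%SET; rewrite cards1; lra.
have upper := expected_spreading_time_le (v0 := v0) calls n2
  (fun S => potential_upper p n%:R K A B #|~: S|%:R).
have lower := expected_spreading_time_ge (v0 := v0) calls n2
  (fun S => potential_lower p n%:R A' B' #|~: S|%:R).
have {}upper : (expected_spreading_time P call v0 <=
    (ln (n%:R : R) / ln (1 + p) + p^-1 * ln (n%:R : R) + (K / p + A + B))%:E)%E.
  apply: le_trans (upper _ _) _ => [S vS|S vS ST|].
  - rewrite /potential_upper cardC.
    have k1 : 1 <= #|S|%:R :> R by rewrite ler1n card_gt0; apply/set0Pn; exists v0.
    have kn : #|S|%:R <= n%:R :> R by rewrite ler_nat -[leqRHS]card_ord max_card.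
    have u0 : 0 <= #|~: S|%:R :> R by [].
    move: #|~: S|%:R u0 => u u0; move: #|S|%:R k1 kn => k k1 kn.
    have lnk : ln k <= ln n%:R by rewrite ler_ln ?posrE//; lra.
    have lnu : 0 <= ln (1 + u) by apply: ln_ge0; lra.
    apply: addr_ge0; last by rewrite divr_ge0//; lra.
    apply: addr_ge0; last by rewrite mulr_ge0// divr_ge0//; lra.
    apply: addr_ge0; first by rewrite divr_ge0// ?subr_ge0// ltW.
    apply: divr_ge0; last exact: ltW.
    by apply: addr_ge0 => //; apply: mulr_ge0 => //; apply: divr_ge0; lra.
  - apply: (round_potential_upper_le _ _ _ v0) => //.
      by rewrite /A -mulrA divfK// gt_eqF.
    by rewrite /B -mulrA divfK// gt_eqF.
  (* At the start [u = n - 1] and one node is informed: the logarithms give exactly the two main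
     terms, and the corrections are at most [K / p], [A] and [B]. *)
  rewrite lee_fin card1 /potential_upper.
  have -> : n%:R - (n%:R - 1) = 1 :> R by ring.
  have -> : 1 + (n%:R - 1) = n%:R :> R by ring.
  rewrite ln1 subr0 divr1 mulrDl [p^-1 * _]mulrC.
  have n1 : (n%:R - 1) / n%:R <= 1 :> R by rewrite ler_pdivrMr; lra.
  have p0 : 0 <= p^-1 by rewrite invr_ge0 ltW.
  have := ler_wpM2r p0 (ler_wpM2l K0 n1); have := ler_wpM2l A0 n1; lra.
have {}lower : ((ln (n%:R : R) / ln (1 + p) + p^-1 * ln (n%:R : R) - (A' + B' + 1))%:E <=
    expected_spreading_time P call v0)%E.
  apply: le_trans (lower _) => [|S vS ST]; last first.
    apply: (round_potential_lower_ge _ _ _ v0) => //.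
      by rewrite /A' divfK// gt_eqF.
    by rewrite /B' divfK// gt_eqF.
  (* At the end [u = 0] the potential equals [B'], which is subtracted together with the slack 1. *)
  rewrite lee_fin card1 finset.setCT cards0 /potential_lower.
  have -> : n%:R - (n%:R - 1) = 1 :> R by ring.
  have -> : 1 + (n%:R - 1) = n%:R :> R by ring.
  rewrite subr0 addr0 ln1 sqrtr1 subrr subr0 !mul0r mulr0 divr1 [p^-1 * _]mulrC.
  have n1 : (n%:R - 1) / n%:R <= 1 :> R by rewrite ler_pdivrMr; lra.
  have := ler_wpM2l A'0 n1.
  have : 0 <= B' / Num.sqrt n%:R by rewrite divr_ge0.
  lra.
move: lower upper; case: (expected_spreading_time P call v0) => [r| |]//=.
rewrite !lee_fin => lower upper; rewrite ler_norml; apply/andP.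
have Kp : 0 <= K / p by rewrite divr_ge0// ltW.
split; lra.
Qed.
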